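(* Let $\lambda\vdash 2n$. The operators $\pi_0,\pi_1,\dots,\pi_{n-1}$ on $\mathbb C\mathsf{SDT}(\lambda)$ define an action of the type-$B$ $0$-Hecke algebra $H_n^B(0)$ on $\mathbb C\mathsf{SDT}(\lambda)$.
   Context: $H_n^B(0)$ is the $\mathbb C$-algebra generated by $\pi_0,\dots,\pi_{n-1}$ with relations $\pi_i^2=-\pi_i$, $\pi_i\pi_j=\pi_j\pi_i$ for $|i-j|\ge 2$, $\pi_i\pi_{i+1}\pi_i=\pi_{i+1}\pi_i\pi_{i+1}$ for $1\le i\le n-2$, and $\pi_0\pi_1\pi_0\pi_1=\pi_1\pi_0\pi_1\pi_0$. A domino tiling of $\lambda$ is a tiling of its Young diagram (English convention) by $1\times2$ and $2\times1$ dominoes. A standard domino tableau of shape $\lambda$ is a bijective filling of the dominoes of a domino tiling of $\lambda$ with $[n]$ such that entries increase from left to right along rows and from top to bottom in columns; $\mathsf{SDT}(\lambda)$ is the set of these, and $\mathbb C\mathsf{SDT}(\lambda)$ the vector space with this basis. $\mathrm{dom}_i(T)$ is the domino with entry $i$. $i\in[0,n-1]$ is a descent of $T$ if either $i=0$ and $\mathrm{dom}_1(T)$ is vertical, or $i>0$ and $\mathrm{dom}_{i+1}(T)$ is strictly lower than $\mathrm{dom}_i(T)$ (every cell of $\mathrm{dom}_{i+1}(T)$ lies in a row strictly below every cell of $\mathrm{dom}_i(T)$); $\mathrm{Des}(T)$ is the set of descents. For $1\le i\le n-1$, $s_i(T)$ is the filling obtained by exchanging entries $i$ and $i+1$. If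 $\mathrm{dom}_1(T)$ and $\mathrm{dom}_2(T)$ tile the northwest-most $2\times2$ square, $s_0(T)$ is obtained by switching the orientation of both dominoes, placing $1$ left of $2$ if $1$ was above $2$ in $T$, and $1$ above $2$ if $1$ was left of $2$ in $T$; otherwise $s_0(T)$ is undefined and regarded as not in $\mathsf{SDT}(\lambda)$. Define $\pi_i(T)=-T$ if $i\in\mathrm{Des}(T)$; $\pi_i(T)=0$ if $i\notin\mathrm{Des}(T)$ and $s_i(T)\notin\mathsf{SDT}(\lambda)$; $\pi_i(T)=s_i(T)$ if $i\notin\mathrm{Des}(T)$ and $s_i(T)\in\mathsf{SDT}(\lambda)$; extend linearly. *)

(* Defs.v *)
From HB Require Import structures.
From mathcomp Require Import all_boot all_order all_algebra perm.
From mathcomp Require Import boolp reals complex monalg.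
Set Implicit Arguments.
Unset Strict Implicit.
Unset Printing Implicit Defensive.
Import GRing.Theory.
Local Open Scope ring_scope.
Local Open Scope quotient_scope.

Section TwoSidedIdeal.
Context (A : pzRingType) (S : A -> Prop).

Inductive ideal_span : A -> Prop :=
| ideal_span_gen x : S x -> ideal_span x
| ideal_span0 : ideal_span 0
| ideal_spanD x y : ideal_span x -> ideal_span y -> ideal_span (x + y)
| ideal_spanMl a x : ideal_span x -> ideal_span (a * x)
| ideal_spanMr a x : ideal_span x -> ideal_span (x * a).

Definition ideal : {pred A} := fun x => `[< ideal_span x >].

Lemma idealP x : reflect (ideal_span x) (x \in ideal).
Proof. exact: asboolP. Qed.

Lemma ideal_zmod_closed : zmod_closed ideal.
Proof.
split=> [|x y /idealP xI /idealP yI]; apply/idealP; first exact: ideal_span0.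
by apply: ideal_spanD => //; rewrite -mulN1r; apply: ideal_spanMl.
Qed.
HB.instance Definition _ := GRing.isZmodClosed.Build A ideal ideal_zmod_closed.

Lemma idealMl a x : x \in ideal -> a * x \in ideal.
Proof. by move=> /idealP xI; apply/idealP; apply: ideal_spanMl. Qed.

Lemma idealMr a x : x \in ideal -> x * a \in ideal.
Proof. by move=> /idealP xI; apply/idealP; apply: ideal_spanMr. Qed.

End TwoSidedIdeal.

(* MathComp only equips quotients of commutative rings with a ring structure.
   The quotient may be trivial, whereas algebras are nontrivial in MathComp, so
   only a ring and a module structure are given in general. *)
Section QuotientAlgebra.
Context (R : comNzRingType) (A : algType R) (S : A -> Prop).

Definition quot_alg : Type := Quotient.quot (ideal S).
HB.instance Definition _ := Choice.on quot_alg.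
HB.instance Definition _ := GRing.Zmodule.on quot_alg.
HB.instance Definition _ := EqQuotient.on quot_alg.

Definition quot_pi : A -> quot_alg := \pi_quot_alg.

Lemma quot_piP x y : reflect (quot_pi x = quot_pi y) (x - y \in ideal S).
Proof. by rewrite (Quotient.idealrBE (ideal S)); apply: eqP. Qed.

Lemma quot_piK x : quot_pi (repr x) = x.
Proof. exact: reprK. Qed.

Lemma quot_pi_is_zmod_morphism : zmod_morphism quot_pi.
Proof. by move=> x y; rewrite /quot_pi !piE. Qed.
HB.instance Definition _ :=
  GRing.isZmodMorphism.Build A quot_alg quot_pi quot_pi_is_zmod_morphism.

Definition quot_one : quot_alg := quot_pi 1.
Definition quot_mul (x y : quot_alg) : quot_alg := quot_pi (repr x * repr y).
Definition quot_scale (c : R) (x : quot_alg) : quot_alg :=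
  quot_pi (c *: repr x).

Lemma repr_quot_pi x : repr (quot_pi x) - x \in ideal S.
Proof. by apply/quot_piP; rewrite quot_piK. Qed.

Lemma quot_piM x y : quot_mul (quot_pi x) (quot_pi y) = quot_pi (x * y).
Proof.
apply/quot_piP; rewrite -(subrKA (x * repr (quot_pi y))) -mulrBl -mulrBr.
apply: rpredD; first by apply: idealMr; exact: repr_quot_pi.
by apply: idealMl; exact: repr_quot_pi.
Qed.

Lemma quot_piZ c x : quot_scale c (quot_pi x) = quot_pi (c *: x).
Proof.
by apply/quot_piP; rewrite -scalerBr -mulr_algl idealMl // repr_quot_pi.
Qed.

Lemma quot_ind (P : quot_alg -> Prop) :
  (forall x, P (quot_pi x)) -> forall x, P x.
Proof. by move=> h x; rewrite -(quot_piK x). Qed.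

Fact quot_mulA : associative quot_mul.
Proof.
elim/quot_ind=> x; elim/quot_ind=> y; elim/quot_ind=> z.
by rewrite !quot_piM mulrA.
Qed.
Fact quot_mul1 : left_id quot_one quot_mul.
Proof. by elim/quot_ind=> x; rewrite quot_piM mul1r. Qed.
Fact quot_1mul : right_id quot_one quot_mul.
Proof. by elim/quot_ind=> x; rewrite quot_piM mulr1. Qed.
Fact quot_mulDl : left_distributive quot_mul +%R.
Proof.
elim/quot_ind=> x; elim/quot_ind=> y; elim/quot_ind=> z.
by rewrite -raddfD !quot_piM mulrDl raddfD.
Qed.
Fact quot_mulDr : right_distributive quot_mul +%R.
Proof.
elim/quot_ind=> x; elim/quot_ind=> y; elim/quot_ind=> z.
by rewrite -raddfD !quot_piM mulrDr raddfD.
Qed.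
HB.instance Definition _ := GRing.Zmodule_isPzRing.Build quot_alg
  quot_mulA quot_mul1 quot_1mul quot_mulDl quot_mulDr.

Fact quot_scaleA a b x : quot_scale a (quot_scale b x) = quot_scale (a * b) x.
Proof. by elim/quot_ind: x => x; rewrite !quot_piZ scalerA. Qed.
Fact quot_scale1 : left_id 1 quot_scale.
Proof. by elim/quot_ind=> x; rewrite quot_piZ scale1r. Qed.
Fact quot_scaleDr : right_distributive quot_scale +%R.
Proof.
move=> a; elim/quot_ind=> x; elim/quot_ind=> y.
by rewrite -raddfD !quot_piZ scalerDr raddfD.
Qed.
Fact quot_scaleDl x : {morph quot_scale^~ x : a b / a + b}.
Proof.
by elim/quot_ind: x => x a b; rewrite !quot_piZ scalerDl raddfD.
Qed.
HB.instance Definition _ := GRing.Zmodule_isLmodule.Build R quot_alg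
  quot_scaleA quot_scale1 quot_scaleDr quot_scaleDl.

Fact quot_scaleAl a (x y : quot_alg) : a *: (x * y) = (a *: x) * y.
Proof.
elim/quot_ind: x => x; elim/quot_ind: y => y.
rewrite /GRing.scale /GRing.mul /=.
by rewrite !(quot_piM, quot_piZ) scalerAl.
Qed.

Fact quot_scaleAr a (x y : quot_alg) : a *: (x * y) = x * (a *: y).
Proof.
elim/quot_ind: x => x; elim/quot_ind: y => y.
rewrite /GRing.scale /GRing.mul /=.
by rewrite !(quot_piM, quot_piZ) scalerAr.
Qed.

End QuotientAlgebra.

(* An alias, because monalg only declares monoid algebras of commutative monoids
   as algebras and that instance shadows any other one on malg. *)
Section FreeAlgebra.
Context (R : comNzRingType) (I : choiceType).

Definition free_alg : Type := {malg R[{fmonom I}]}.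
HB.instance Definition _ := GRing.Lalgebra.copy free_alg {malg R[{fmonom I}]}.

Fact free_scaleAr c (x y : free_alg) : c *: (x * y) = x * (c *: y).
Proof.
have cC (z : {malg R[{fmonom I}]}) : z * c%:MP = c *: z.
  rewrite -mul_malgC !malgM_def fgmulUg fgmulgU.
  by apply: eq_bigr => k _; rewrite mulrC mul1m mulm1.
by rewrite -[LHS]cC -[in RHS](cC y) mulrA.
Qed.
HB.instance Definition _ :=
  GRing.LSemiAlgebra_isSemiAlgebra.Build R free_alg free_scaleAr.

Definition free_gen (i : I) : free_alg := << fmu i >> : {malg R[{fmonom I}]}.

End FreeAlgebra.

(* The defining relations, as pairs (left-hand side, right-hand side), for a
   family p of elements of a ring. *)
Inductive heckeB0_rel (n : nat) (A : pzRingType) (p : 'I_n -> A) :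
  A -> A -> Prop :=
| heckeB0_quad (i : 'I_n) :
    heckeB0_rel p (p i * p i) (- p i)
| heckeB0_comm (i j : 'I_n) : (i.+2 <= j)%N || (j.+2 <= i)%N ->
    heckeB0_rel p (p i * p j) (p j * p i)
| heckeB0_braid3 (i j : 'I_n) : (1 <= i)%N -> j = i.+1 :> nat ->
    heckeB0_rel p (p i * p j * p i) (p j * p i * p j)
| heckeB0_braid4 (i j : 'I_n) : i = 0%N :> nat -> j = 1%N :> nat ->
    heckeB0_rel p (p i * p j * p i * p j) (p j * p i * p j * p i).

Definition heckeB0_relator (n : nat) (A : pzRingType) (p : 'I_n -> A) (x : A) :=
  exists l r, heckeB0_rel p l r /\ x = l - r.

(* All defining relations hold when every generator is sent to 0. *)
Lemma heckeB0_ideal_augmentation (n : nat) (A R : pzRingType) (p : 'I_n -> A)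
    (e : A -> R) : (forall x y, e (x + y) = e x + e y) ->
    (forall x y, e (x * y) = e x * e y) -> (forall i, e (p i) = 0) ->
  forall x, ideal_span (heckeB0_relator p) x -> e x = 0.
Proof.
move=> eD eM ep; have e0 : e 0 = 0.
  by apply: (addrI (e 0)); rewrite -eD !addr0.
have eN x : e (- x) = - e x.
  by apply: (addrI (e x)); rewrite -eD !subrr.
move=> x; elim=> {x} [x [l [r [+ ->]]]|//|x y _ IHx _ IHy|a x _ IH|a x _ IH].
- by case=> *; rewrite eD eN ?eN !eM !ep ?(mulr0, oppr0, addr0).
- by rewrite eD IHx IHy addr0.
- by rewrite eM IH mulr0.
- by rewrite eM IH mul0r.
Qed.

Section HeckeB.
Context (R : comNzRingType) (n : nat).

Local Notation rels := (heckeB0_relator (@free_gen R 'I_n)).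

Definition heckeB0 : Type := quot_alg rels.
HB.instance Definition _ := GRing.PzRing.on heckeB0.
HB.instance Definition _ := GRing.Lmodule.on heckeB0.

Fact heckeB0_nontrivial : 1 != 0 :> heckeB0.
Proof.
apply/eqP => h1.
have /quot_piP : quot_pi rels 1 = quot_pi rels 0.
  by rewrite raddf0; exact: h1.
rewrite subr0 => /idealP.
move/(@heckeB0_ideal_augmentation _ _ _ _
        (mcoeff mone : {malg R[{fmonom 'I_n}]} -> R)).
have -> : mcoeff mone (1 : {malg R[{fmonom 'I_n}]}) = 1 by exact: rmorph1.
move=> h; have /eqP := oner_neq0 R; apply; apply: h.
- exact: mcoeffD.
- exact: (rmorphM (mcoeff mone)).
- by move=> i; rewrite /free_gen mcoeffU fm1_eq1.
Qed.
HB.instance Definition _ :=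
  GRing.PzSemiRing_isNonZero.Build heckeB0 heckeB0_nontrivial.
HB.instance Definition _ := GRing.LSemiModule_isLSemiAlgebra.Build R heckeB0
  (@quot_scaleAl _ _ rels).
HB.instance Definition _ := GRing.LSemiAlgebra_isSemiAlgebra.Build R heckeB0
  (@quot_scaleAr _ _ rels).

Definition heckeB0_gen (i : 'I_n) : heckeB0 := quot_pi rels (@free_gen R 'I_n i).

End HeckeB.

Definition is_algebra_action (R : comNzRingType) (A : algType R)
    (V : lmodType R) (act : A -> V -> V) : Prop :=
  [/\ forall a, linear (act a),
      forall v, linear (act^~ v),
      forall v, act 1 v = v
    & forall a b v, act (a * b) v = act a (act b v)].

Definition is_partition_of (m : nat) (lam : seq nat) : bool :=
  [&& sorted geq lam, 0%N \notin lam & sumn lam == m].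

(* Cells are pairs (row, column), counted from 0, rows going downwards. *)
Definition diagram (lam : seq nat) : seq (nat * nat) :=
  [seq (r, c) | r <- iota 0 (size lam), c <- iota 0 (nth 0%N lam r)].

(* (r, c, b) is the domino with northwest-most cell (r, c), vertical iff b.
   The bound 2n on coordinates loses nothing for a diagram with 2n cells. *)
Definition domino (n : nat) : finType := ('I_n.*2 * 'I_n.*2 * bool)%type.

Section Dominoes.
Context (n : nat).
Implicit Types (d : domino n) (lam : seq nat).

Definition vertical d : bool := d.2.

Definition dcells d : seq (nat * nat) :=
  let: (r, c, b) := d in
  [:: (r : nat, c : nat); if b then (r.+1, c : nat) else (r : nat, c.+1)].

Definition is_tiling lam (D : {set domino n}) : bool :=
  [forall d in D, all [in diagram lam] (dcells d)] &&
  all (fun x => #|[set d in D | x \in dcells d]| == 1%N) (diagram lam).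

Definition strictly_lower d d' : bool :=
  all (fun x => all (fun y => (y.1 < x.1)%N) (dcells d')) (dcells d).

Definition transpose d : domino n := let: (r, c, b) := d in (c, r, ~~ b).

(* Entries are shifted by one: T k is the domino with entry k + 1. *)
Definition filling : finType := {ffun 'I_n -> domino n}.
Implicit Type T : filling.

(* Two cells of one domino carry the same entry; for distinct dominoes the
   inequality on entries is strict. *)
Definition increasing T : bool :=
  [forall i : 'I_n, forall j : 'I_n, all (fun x => all (fun y =>
     ((x.1 == y.1) && (x.2 < y.2)%N) || ((x.2 == y.2) && (x.1 < y.1)%N)
       ==> (i <= j)%N)
     (dcells (T j))) (dcells (T i))].

Definition is_SDT lam T : bool :=
  [&& injectiveb T, is_tiling lam [set T i | i : 'I_n] & increasing T].

Definition pred_ord (i : 'I_n) : 'I_n :=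
  Ordinal (leq_ltn_trans (leq_pred i) (ltn_ord i)).

(* For i > 0, the entries i + 1 and i are carried by T i and T (pred_ord i). *)
Definition descent T (i : 'I_n) : bool :=
  if i == 0%N :> nat then vertical (T i) else strictly_lower (T i) (T (pred_ord i)).

(* For i = 0, transposing both dominoes inside the northwest-most square turns
   "1 above 2" into "1 left of 2" and conversely. *)
Definition swap T (i : 'I_n) : option filling :=
  if i == 0%N :> nat then
    if (insub 1%N : option 'I_n) is Some j then
      if is_tiling [:: 2; 2]%N [set T i; T j] then
        Some [ffun k => if (k == i) || (k == j) then transpose (T k) else T k]
      else None
    else None
  else Some [ffun k => T (tperm (pred_ord i) i k)].

End Dominoes.

Definition SDT (n : nat) (lam : seq nat) : finType :=
  {T : filling n | is_SDT lam T}.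

Section Operators.
Context (R : comNzRingType) (n : nat) (lam : seq nat).

Definition SDTmod : lmodType R := {ffun SDT n lam -> R^o}.

Definition SDTbasis (T : SDT n lam) : SDTmod :=
  [ffun U => (U == T)%:R].

Definition SDTswap (T : SDT n lam) (i : 'I_n) : option (SDT n lam) :=
  obind insub (swap (val T) i).

Definition SDTop_basis (i : 'I_n) (T : SDT n lam) : SDTmod :=
  if descent (val T) i then - SDTbasis T
  else if SDTswap T i is Some U then SDTbasis U else 0.

Definition SDTop (i : 'I_n) (v : SDTmod) : SDTmod :=
  \sum_(T : SDT n lam) v T *: SDTop_basis i T.

End Operators.

(* Main.v *)
(* The operators on standard domino tableaux are linear, so they extend to the
   free algebra, and everything reduces to checking the defining relations on
   basis tableaux.

   For i > 0 the operator pi_i only depends on the relation "strictly lower"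
   between the dominoes with entries i and i + 1: it is -1 if the second one is
   strictly lower, the exchange of the entries if the first one is, and 0 if the
   two share a row.  No column condition survives: in a standard tableau two
   dominoes sharing a column already are in the right order.  The quadratic, the
   commutation and the length 3 braid relations thus hold for exchanges
   prescribed by any strict partial order.

   The operator pi_0 is -1 if the first domino is vertical, and otherwise turns
   the northwest square when it is tiled by the first two dominoes.  As the
   first domino occupies the northwest corner, pi_1 is always diagonal, with
   value 0 on a square tiled by vertical dominoes; this gives the length 4 braid
   relation.  Only the commutation of pi_0 with pi_2 needs a closer look. *)

From HB Require Import structures.
Require Import Defs.
From mathcomp Require Import all_boot all_order all_algebra perm.
From mathcomp Require Import reals complex finmap monalg.
From mathcomp Require Import zify.
Set Implicit Arguments.
Unset Strict Implicit.
Unset Printing Implicit Defensive.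
Import GRing.Theory.
Local Open Scope ring_scope.

(** * Extending operators to the algebra *)

Section FreeAction.
Context (R : comNzRingType) (I : choiceType) (V : lmodType R).
Variable op : I -> {linear V -> V}.
Implicit Types (m : {fmonom I}) (x y : free_alg R I) (u v : V).

(** The last letter of a word acts first, so that concatenation of words becomes composition of
    operators. *)
Definition word_act m v : V := foldr (fun i u => op i u) v (m : seq I).

Fact word_act_is_linear m : linear (word_act m).
Proof.
rewrite /word_act; elim: (m : seq I) => [//|i s IHs] c u v /=.
by rewrite IHs linearP.
Qed.
HB.instance Definition _ m :=
  GRing.isLinear.Build R V V *:%R (word_act m) (word_act_is_linear m).

Lemma word_actM m1 m2 v :
  word_act (mmul m1 m2) v = word_act m1 (word_act m2 v).
Proof. by rewrite /word_act fmM foldr_cat. Qed.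

Definition free_act (x : free_alg R I) (v : V) : V :=
  \sum_(m <- msupp (x : {malg R[{fmonom I}]}))
     mcoeff m (x : {malg R[{fmonom I}]}) *: word_act m v.

Lemma free_actEw (d : {fset {fmonom I}}) (x : {malg R[{fmonom I}]}) v :
  fsubset (msupp x) d ->
  free_act x v = \sum_(m <- d) mcoeff m x *: word_act m v.
Proof.
move=> le; rewrite [LHS](big_fset_incl _ le) => //= k kd /mcoeff_outdom ->.
by rewrite scale0r.
Qed.

(** The arguments of [free_act] are swapped so that linearity in the algebra element can be declared
    as an instance. *)
Definition free_eval v x : V := free_act x v.

Fact free_eval_linear v : linear (free_eval v).
Proof.
move=> c x y; rewrite /free_eval.
pose d := (msupp x `|` msupp y `|` msupp (c *: x + y)%R)%fset.
rewrite !(free_actEw (d := d)) ?fsubsetUr //; last first.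
- by apply/fsubsetP => m; rewrite !inE => ->.
- by apply/fsubsetP => m; rewrite !inE => ->; rewrite orbT.
rewrite scaler_sumr -big_split; apply: eq_bigr => k _ /=.
by rewrite scalerA -scalerDl mcoeffD mcoeffZ.
Qed.
HB.instance Definition _ v :=
  GRing.isLinear.Build R (free_alg R I) V *:%R (free_eval v)
    (free_eval_linear v).

Lemma free_act_linear x : linear (free_act x).
Proof.
move=> c u v; rewrite /free_act scaler_sumr -big_split.
by apply: eq_bigr => k _; rewrite /= linearP scalerDr !scalerA mulrC.
Qed.
HB.instance Definition _ x :=
  GRing.isLinear.Build R V V *:%R (free_act x) (free_act_linear x).

Lemma free_actU c m v :
  free_act (<< c *g m >> : {malg R[{fmonom I}]}) v = c *: word_act m v.
Proof. by rewrite (free_actEw _ msuppU_le) big_seq_fset1 mcoeffUU. Qed.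

Lemma free_act1 v : free_act 1 v = v.
Proof.
have -> : (1 : free_alg R I) = << mone >> :> {malg R[{fmonom I}]} by [].
by rewrite free_actU scale1r /word_act fm1.
Qed.

Lemma free_act_gen i v : free_act (free_gen R i) v = op i v.
Proof. by rewrite free_actU scale1r /word_act fmU. Qed.

Lemma free_actM x y v : free_act (x * y) v = free_act x (free_act y v).
Proof.
(* [fgmul] is the convolution product: a double sum, over the two supports, of multiples of single
   words. *)
have -> : x * y = fgmul x y by [].
rewrite [LHS](raddf_sum (free_eval v)) [RHS]/free_act; apply: eq_bigr => i _.
rewrite [LHS](raddf_sum (free_eval v)) [free_act y v]/free_act.
rewrite linear_sum scaler_sumr.
by apply: eq_bigr => j _; rewrite [LHS]free_actU word_actM linearZ scalerA.
Qed.

Lemma free_act0 v : free_act 0 v = 0.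
Proof. exact: (raddf0 (free_eval v)). Qed.

Lemma free_actN x v : free_act (- x) v = - free_act x v.
Proof. exact: (raddfN (free_eval v)). Qed.

Lemma free_actD x y v : free_act (x + y) v = free_act x v + free_act y v.
Proof. exact: (raddfD (free_eval v)). Qed.

Lemma free_actB x y v : free_act (x - y) v = free_act x v - free_act y v.
Proof. exact: (raddfB (free_eval v)). Qed.

Lemma free_actZ c x v : free_act (c *: x) v = c *: free_act x v.
Proof. exact: (linearZ_LR (free_eval v)). Qed.

End FreeAction.

(** * Passage from the free algebra to its quotient by the defining relations *)

Section HeckeAction.
Context (R : comNzRingType) (n : nat) (V : lmodType R).
Variable op : 'I_n -> {linear V -> V}.

Hypothesis op_quad : forall i v, op i (op i v) = - op i v.
Hypothesis op_comm : forall (i j : 'I_n) v, (i.+2 <= j)%N ->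
  op i (op j v) = op j (op i v).
Hypothesis op_braid3 : forall (i j : 'I_n) v, (1 <= i)%N -> j = i.+1 :> nat ->
  op i (op j (op i v)) = op j (op i (op j v)).
Hypothesis op_braid4 : forall (i j : 'I_n) v, i = 0%N :> nat ->
  j = 1%N :> nat ->
  op i (op j (op i (op j v))) = op j (op i (op j (op i v))).

(* An abstract ring A, since matching products against elements of the free
   algebra unfolds the convolution product and does not terminate. *)
Lemma heckeB0_rel_act (A : pzRingType) (p : 'I_n -> A) (a : A -> V -> V) l r v :
    (forall x v, a (- x) v = - a x v) ->
    (forall x y v, a (x * y) v = a x (a y v)) ->
    (forall i v, a (p i) v = op i v) ->
  heckeB0_rel p l r -> a l v = a r v.
Proof.
move=> aN aM ap.
case=> [i|i j /orP[] ij|i j i0 ij|i j i0 j1]; rewrite ?(aN, aM) !ap.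
- exact: op_quad.
- exact: op_comm.
- exact/esym/op_comm.
- exact: op_braid3.
- exact: op_braid4.
Qed.

Let rels := heckeB0_relator (@free_gen R 'I_n).

(** Induction over the generation of the ideal, for all [v] at once: in the case [x * a] the
    induction hypothesis is used at the image of [v] under [a]. *)
Lemma free_act_ideal x v : ideal_span rels x -> free_act op x v = 0.
Proof.
move=> sx; elim: sx v => {x} [x [l [r [lr ->]]] v|v|x y _ IHx _ IHy v
                             |a x _ IHx v|a x _ IHx v].
- apply/eqP; rewrite free_actB subr_eq0; apply/eqP.
  apply: heckeB0_rel_act lr; [exact: free_actN|exact: free_actM|].
  exact: free_act_gen.
- by rewrite free_act0.
- by rewrite free_actD IHx IHy addr0.
- by rewrite free_actM IHx raddf0.
- by rewrite free_actM IHx.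
Qed.

(** A class acts through its chosen representative. By [hecke_act_pi] the choice is immaterial: two
    representatives differ by an element of the ideal, which acts as zero. *)
Definition hecke_act (h : heckeB0 R n) (v : V) : V := free_act op (repr h) v.

Lemma hecke_act_pi x v : hecke_act (quot_pi rels x) v = free_act op x v.
Proof.
apply/eqP; rewrite -subr_eq0 -free_actB.
by apply/eqP/free_act_ideal/idealP/repr_quot_pi.
Qed.

Lemma hecke_act_gen i v : hecke_act (heckeB0_gen R i) v = op i v.
Proof. by rewrite hecke_act_pi free_act_gen. Qed.

Lemma hecke_act_is_action : is_algebra_action hecke_act.
Proof.
split=> [a|v c||].
- exact: linearP.
- elim/quot_ind=> x; elim/quot_ind=> y.
  have -> : c *: (quot_pi rels x : heckeB0 R n) + quot_pi rels y
          = quot_pi rels (c *: x + y) by rewrite raddfD /= -quot_piZ.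
  by rewrite !hecke_act_pi free_actD free_actZ.
- by move=> v; rewrite [LHS]hecke_act_pi free_act1.
- elim/quot_ind=> x; elim/quot_ind=> y v.
  have -> : (quot_pi rels x : heckeB0 R n) * quot_pi rels y
          = quot_pi rels (x * y) by rewrite -quot_piM.
  by rewrite !hecke_act_pi free_actM.
Qed.

End HeckeAction.

(** * Operators prescribed by a strict order *)

Section Words.
Context (V : zmodType).

(** Each operator negates, moves or kills a basis vector, and neither move changes which of these
    the other operator does. As the moves commute, both composites agree in every combination of
    cases. [P] marks the valid indices. *)
Lemma signed_moves_commute (W : Type) (P : W -> Prop) (e : W -> V)
    (f g : {additive V -> V}) (df sf dg sg : pred W) (F G : W -> W) :
    (forall t, P t -> f (e t) = if df t then - e t else
                                if sf t then e (F t) else 0) ->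
    (forall t, P t -> g (e t) = if dg t then - e t else
                                if sg t then e (G t) else 0) ->
    (forall t, P t -> ~~ df t -> sf t -> P (F t)) ->
    (forall t, P t -> ~~ dg t -> sg t -> P (G t)) ->
    (forall t, (df (G t) = df t) * (sf (G t) = sf t)) ->
    (forall t, (dg (F t) = dg t) * (sg (F t) = sg t)) ->
    (forall t, F (G t) = G (F t)) ->
  forall t, P t -> f (g (e t)) = g (f (e t)).
Proof.
move=> fE gE PF PG fG gF FG t Pt; rewrite fE // gE //.
case Edf: (df t); case Edg: (dg t); rewrite ?raddfN /=.
- by rewrite fE // gE // Edf Edg.
- rewrite gE // Edg; case Esg: (sg t); rewrite ?raddf0 ?oppr0 //.
  by rewrite fE ?fG ?Edf //; apply: PG; rewrite // Edg.
- rewrite fE // Edf; case Esf: (sf t); rewrite ?raddf0 ?oppr0 //.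
  by rewrite gE ?gF ?Edg //; apply: PF; rewrite // Edf.
case Esf: (sf t); case Esg: (sg t); rewrite ?raddf0 //.
- have PFt : P (F t) by apply: PF; rewrite // Edf.
  have PGt : P (G t) by apply: PG; rewrite // Edg.
  by rewrite fE // gE // !fG !gF Edf Edg Esf Esg FG.
- have PFt : P (F t) by apply: PF; rewrite // Edf.
  by rewrite gE // !gF Edg Esg.
- have PGt : P (G t) by apply: PG; rewrite // Edg.
  by rewrite fE // !fG Edf Esf.
Qed.

(** Three positions hold [x], [y], [z]; [f] sorts the first two and [g] the last two, killing
    incomparable neighbours. The comparisons among the three determine both sides, so a finite case
    check suffices. *)
Lemma signed_moves_braid (D : Type) (L : rel D) (P : D -> D -> D -> Prop)
    (e : D -> D -> D -> V) (f g : {additive V -> V}) :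
    irreflexive L -> transitive L ->
    (forall x y z, P x y z -> L x y -> P y x z) ->
    (forall x y z, P x y z -> L y z -> P x z y) ->
    (forall x y z, P x y z -> f (e x y z) =
       if L y x then - e x y z else if L x y then e y x z else 0) ->
    (forall x y z, P x y z -> g (e x y z) =
       if L z y then - e x y z else if L y z then e x z y else 0) ->
  forall x y z, P x y z ->
    f (g (f (e x y z))) = g (f (g (e x y z))).
Proof.
move=> Lirr Ltr PF PG fE gE a b c Pabc.
have addE := (raddfN f, raddfN g, raddf0 f, raddf0 g, oppr0).
have Lasym x y : L x y -> L y x = false.
  by move=> xy; apply/negP => /(Ltr _ _ _ xy); rewrite Lirr.
(* Patterns violating asymmetry or transitivity are discarded; on the others both words are
   computed. *)
have [ab|/negbTE ab] := boolP (L a b); have [ba|/negbTE ba] := boolP (L b a);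
  try (by rewrite (Lasym _ _ ab) in ba);
have [bc|/negbTE bc] := boolP (L b c); have [cb|/negbTE cb] := boolP (L c b);
  try (by rewrite (Lasym _ _ bc) in cb);
have [ac|/negbTE ac] := boolP (L a c); have [ca|/negbTE ca] := boolP (L c a);
  try (by rewrite (Lasym _ _ ac) in ca);
  try (by rewrite (Ltr _ _ _ ab bc) in ac);
  try (by rewrite (Ltr _ _ _ ac cb) in ab);
  try (by rewrite (Ltr _ _ _ ba ac) in bc);
  try (by rewrite (Ltr _ _ _ bc ca) in ba);
  try (by rewrite (Ltr _ _ _ ca ab) in cb);
  try (by rewrite (Ltr _ _ _ cb ba) in ca);
clear Lirr Ltr Lasym;
(* Each word consists of three operators, hence three rounds; [eauto] derives the validity of the
   triples met from [PF] and [PG]. *)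
do 3 (rewrite ?addE; try (rewrite fE; last by eauto 7);
      try (rewrite gE; last by eauto 7); rewrite ?(ab, ba, bc, cb, ac, ca));
by rewrite ?addE.
Qed.

End Words.

(** * Standard domino tableaux *)

Local Notation low := (@strictly_lower _).

Section Tableaux.
Context (n : nat) (lam : seq nat).
Implicit Types (d : domino n) (T : filling n) (x y : nat * nat).

Definition before x y : bool :=
  ((x.1 == y.1) && (x.2 < y.2)%N) || ((x.2 == y.2) && (x.1 < y.1)%N).

Lemma nw_in d : (d.1.1 : nat, d.1.2 : nat) \in dcells d.
Proof. by case: d => [[r c] b]; rewrite inE eqxx. Qed.

(** Later arguments only speak of cells and the entries they carry. Injectivity of [T] is absorbed
    into the uniqueness of the entry at a cell, since every domino contains its northwest cell. *)
Lemma is_SDTP T :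
  reflect [/\ forall k x, x \in dcells (T k) -> x \in diagram lam,
              forall k l x, x \in dcells (T k) -> x \in dcells (T l) -> k = l,
              forall x, x \in diagram lam -> exists k, x \in dcells (T k)
            & forall k l x y, x \in dcells (T k) -> y \in dcells (T l) ->
                before x y -> (k <= l)%N]
          (is_SDT lam T).
Proof.
apply: (iffP and3P).
  case=> /injectiveP Tinj /andP[/forall_inP Tin /allP Tcov] /forallP Tincr.
  have Tin' k x : x \in dcells (T k) -> x \in diagram lam.
    move=> xk; have /allP := Tin (T k) (imset_f T (isT : k \in xpredT)).
    exact.
  split=> //.
  - move=> k l x xk xl; apply: Tinj.
    have /cards1P[d dE] := Tcov x (Tin' _ _ xk).
    have : T k \in [set d in [set T i | i : 'I_n] | x \in dcells d].
      by rewrite inE xk imset_f.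
    have : T l \in [set d in [set T i | i : 'I_n] | x \in dcells d].
      by rewrite inE xl imset_f.
    by rewrite dE !inE => /eqP -> /eqP ->.
  - move=> x xD; have /cards1P[d dE] := Tcov x xD.
    have : d \in [set d] by rewrite inE.
    by rewrite -dE inE => /andP[/imsetP[k _ ->] xk]; exists k.
  - move=> k l x y xk yl xy.
    have /forallP/(_ l)/allP/(_ x xk)/allP/(_ y yl)/implyP := Tincr k.
    exact.
case=> Tin Tuniq Tcov Tincr; split.
- apply/injectiveP => k l kl; apply: (Tuniq _ _ _ (nw_in _)).
  by rewrite kl nw_in.
- apply/andP; split.
    by apply/forall_inP => d /imsetP[k _ ->]; apply/allP => x; apply: Tin.
  apply/allP => x /Tcov[k xk]; apply/cards1P; exists (T k).
  apply/setP => d; rewrite !inE; apply/andP/eqP => [[/imsetP[l _ ->] xl]|->].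
    by rewrite (Tuniq _ _ _ xl xk).
  by rewrite imset_f.
- apply/forallP => k; apply/forallP => l.
  apply/allP => x xk; apply/allP => y yl; by apply/implyP; apply: Tincr.
Qed.

Lemma SDT_in T k x : is_SDT lam T -> x \in dcells (T k) -> x \in diagram lam.
Proof. by case/is_SDTP => + _ _ _; apply. Qed.

Lemma SDT_uniq T k l x :
  is_SDT lam T -> x \in dcells (T k) -> x \in dcells (T l) -> k = l.
Proof. by case/is_SDTP => _ + _ _; apply. Qed.

Lemma SDT_cover T x :
  is_SDT lam T -> x \in diagram lam -> exists k, x \in dcells (T k).
Proof. by case/is_SDTP => _ _ + _; apply. Qed.

Lemma SDT_incr T k l x y : is_SDT lam T ->
  x \in dcells (T k) -> y \in dcells (T l) -> before x y -> (k <= l)%N.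
Proof. by case/is_SDTP => _ _ _; apply. Qed.

(** The boolean [d'.2] counts as 1 for a vertical domino, so [d'.1.1 + d'.2] is the last row of
    [d']. *)
Lemma lowE d d' : low d d' = (d'.1.1 + d'.2 < d.1.1)%N.
Proof.
case: d d' => [[r c] b] [[r' c'] b']; rewrite /strictly_lower /= !andbT.
by case: b b' => [] [] /=; lia.
Qed.

Lemma dcells_row d x :
  x \in dcells d -> (d.1.1 <= x.1 <= d.1.1 + d.2)%N.
Proof.
case: d => [[r c] b]; rewrite !inE => /orP[] /eqP-> /=; first by lia.
by case: b => /=; lia.
Qed.

Lemma row_dcells d r : (d.1.1 <= r <= d.1.1 + d.2)%N ->
  exists c, (r, c) \in dcells d.
Proof.
case: d => [[r' c] b] /= h; exists c; rewrite !inE.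
by case: b h => /= h; rewrite !xpair_eqE eqxx ?andbT; lia.
Qed.

Lemma low_irr : irreflexive (@strictly_lower n).
Proof. by move=> d; rewrite lowE; lia. Qed.

Lemma low_trans : transitive (@strictly_lower n).
Proof. by move=> d1 d2 d3; rewrite !lowE; lia. Qed.

Lemma mem_diagram r c :
  ((r, c) \in diagram lam) = (r < size lam)%N && (c < nth 0%N lam r)%N.
Proof.
apply/allpairsPdep/andP => [[r' [c' [+ + [-> ->]]]]|[hr hc]].
  by rewrite !mem_iota !add0n.
by exists r, c; rewrite !mem_iota !add0n.
Qed.

(** * Closure towards the northwest in partition shapes *)

Section Partition.
Hypothesis lamP : is_partition_of n.*2 lam.

Lemma diagram_nw r c r' c' : (r, c) \in diagram lam -> (r' <= r)%N ->
  (c' <= c)%N -> (r', c') \in diagram lam.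
Proof.
case/and3P: lamP => srt _ _; rewrite !mem_diagram => /andP[rs cr] r'r c'c.
have r's := leq_ltn_trans r'r rs; rewrite r's /=.
apply: leq_ltn_trans c'c (leq_trans cr _).
by apply: (sorted_leq_nth (rev_trans leq_trans) leqnn 0%N srt).
Qed.

(** Go up the column to row [r'], then left along that row: both legs stay in the diagram, and
    entries weakly decrease along them. *)
Lemma SDT_nw T k r c r' c' : is_SDT lam T -> (r, c) \in dcells (T k) ->
  (r' <= r)%N -> (c' <= c)%N ->
  exists2 l : 'I_n, (l <= k)%N & (r', c') \in dcells (T l).
Proof.
move=> TS rck r'r c'c; have rcD := SDT_in TS rck.
have [m mP] := SDT_cover TS (diagram_nw rcD r'r (leqnn c)).
have mk : (m <= k)%N.
  have [e|ne] := eqVneq r r'.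
    by rewrite -e in mP; rewrite (SDT_uniq TS rck mP).
  by apply: (SDT_incr TS mP rck); rewrite /before /=; lia.
have [l lP] := SDT_cover TS (diagram_nw rcD r'r c'c).
exists l => //; apply: leq_trans mk.
have [e|ne] := eqVneq c c'.
  by rewrite -e in lP; rewrite (SDT_uniq TS mP lP).
by apply: (SDT_incr TS lP mP); rewrite /before /=; lia.
Qed.

(** By [SDT_nw] the corner carries the least entry. It must be the northwest cell of its domino,
    since the other cell has a positive coordinate. *)
Lemma SDT_first T (i : 'I_n) : i = 0%N :> nat -> is_SDT lam T ->
  (T i).1.1 = 0%N :> nat /\ (T i).1.2 = 0%N :> nat.
Proof.
move=> i0 TS; have [l] := SDT_nw TS (nw_in (T i)) (leq0n _) (leq0n _).
rewrite i0 leqn0 => /eqP l0; have -> : l = i by apply: val_inj; rewrite /= l0.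
case: (T i) => [[r c] b]; rewrite !inE !xpair_eqE /=; case: b;
  by rewrite xpair_eqE; lia.
Qed.

End Partition.

(** * Exchange of two consecutive entries *)

Section Exchange.
Variables (p i : 'I_n).
Hypothesis ip : i = p.+1 :> nat.

Definition exch T : filling n := [ffun k => T (tperm p i k)].

Lemma exchL T : exch T p = T i.
Proof. by rewrite ffunE tpermL. Qed.

Lemma exchR T : exch T i = T p.
Proof. by rewrite ffunE tpermR. Qed.

Lemma exchD T k : k != p -> k != i -> exch T k = T k.
Proof. by move=> kp ki; rewrite ffunE tpermD // eq_sym. Qed.

(** Exchanging consecutive entries can break the order only at the pair [(i, p)], where a cell of
    [T p] would precede one of [T i]; but [T p] lies strictly below [T i]. *)
Lemma exch_SDT T : is_SDT lam T -> low (T p) (T i) -> is_SDT lam (exch T).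
Proof.
move=> TS Tl; apply/is_SDTP; split.
- by move=> k x; rewrite ffunE; apply: SDT_in.
- by move=> k l x; rewrite !ffunE => xk /(SDT_uniq TS xk)/perm_inj.
- move=> x /(SDT_cover TS)[k xk]; exists (tperm p i k).
  by rewrite ffunE tpermK.
- move=> k l x y; rewrite !ffunE => xk yl xy.
  have := SDT_incr TS xk yl xy.
  have [/andP[/eqP ek /eqP el]|] := boolP ((k == i) && (l == p)).
    move: xk yl; rewrite ek el tpermL tpermR => /dcells_row xk /dcells_row yl.
    by move: Tl xy; rewrite lowE /before; lia.
  case: (tpermP p i k) => [->|->|/eqP kp /eqP ki];
  case: (tpermP p i l) => [->|->|/eqP lp /eqP li];
  by [rewrite -!val_eqE /=; lia | move: kp ki; rewrite -!val_eqE /=; lia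
     |move: lp li; rewrite -!val_eqE /=; lia
     |move: kp ki lp li; rewrite -!val_eqE /=; lia].
Qed.

(** Two dominoes neither of which is strictly lower share a row. Their cells in it force an order of
    the entries, which [T] and [exch T] cannot both respect. *)
Lemma exch_notSDT T :
  is_SDT lam T -> ~~ low (T p) (T i) -> ~~ low (T i) (T p) ->
  is_SDT lam (exch T) = false.
Proof.
move=> TS; rewrite !lowE => l1 l2; apply/negP => ES.
(* The row ranges overlap, and the larger of the two first rows lies in both. *)
pose r := maxn (T p).1.1 (T i).1.1.
have [cp xp] : exists c, (r, c) \in dcells (T p) by apply: row_dcells; lia.
have [ci xi] : exists c, (r, c) \in dcells (T i) by apply: row_dcells; lia.
have [lt|lt|eq] := ltngtP cp ci.
- have := @SDT_incr (exch T) i p (r, cp) (r, ci) ES.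
  rewrite !ffunE tpermL tpermR => /(_ xp xi).
  by rewrite /before /= eqxx lt => /(_ isT); lia.
- have := @SDT_incr T i p (r, ci) (r, cp) TS xi xp.
  by rewrite /before /= eqxx lt => /(_ isT); lia.
- rewrite eq in xp; have := SDT_uniq TS xp xi => e.
  by move: ip; rewrite -e; lia.
Qed.

End Exchange.

(** * Flip of the northwest square *)

Section Flip.

(* For a standard T with horizontal first domino, this says that the first two
   dominoes tile the northwest square. *)
Definition square T : bool :=
  [exists j : 'I_n,
     (j == 1%N :> nat) && (dcells (T j) == [:: (1, 0); (1, 1)]%N)].

Definition flip T : filling n :=
  [ffun k : 'I_n => if (k < 2)%N then transpose (T k) else T k].

Lemma dcells_transpose d :
  dcells (transpose d) = [seq (x.2, x.1) | x <- dcells d].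
Proof. by case: d => [[r c] []]. Qed.

Lemma vertical_flip T (i : 'I_n) : i = 0%N :> nat ->
  vertical (flip T i) = ~~ vertical (T i).
Proof. by move=> i0; rewrite ffunE i0 /=; case: (T i) => [[r c] b]. Qed.

Lemma squareE T (j : 'I_n) : j = 1%N :> nat ->
  square T = (dcells (T j) == [:: (1, 0); (1, 1)]%N).
Proof.
move=> j1; apply/existsP/idP => [[k /andP[/eqP k1]]|h]; last first.
  by exists j; rewrite j1.
by have -> : k = j by apply: val_inj; rewrite /= k1 j1.
Qed.

Hypothesis lamP : is_partition_of n.*2 lam.

Lemma SDT_first_horizontal T (i : 'I_n) : i = 0%N :> nat -> is_SDT lam T ->
  ~~ vertical (T i) -> dcells (T i) = [:: (0, 0); (0, 1)]%N.
Proof.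
move=> i0 /(SDT_first lamP i0); case: (T i) => [[r c] b] /= [-> ->].
by rewrite /vertical /= => /negbTE ->.
Qed.

Section FlipSDT.
Variables (T : filling n) (i j : 'I_n).
Hypotheses (i0 : i = 0%N :> nat) (j1 : j = 1%N :> nat).
Hypotheses (TS : is_SDT lam T) (Th : ~~ vertical (T i)) (Tsq : square T).

Let cTi : dcells (T i) = [:: (0, 0); (0, 1)]%N.
Proof. exact: SDT_first_horizontal. Qed.

Let cTj : dcells (T j) = [:: (1, 0); (1, 1)]%N.
Proof. by apply/eqP; rewrite -squareE. Qed.

Lemma dcells_flip0 : dcells (flip T i) = [:: (0, 0); (1, 0)]%N.
Proof. by rewrite ffunE i0 dcells_transpose cTi. Qed.

Lemma dcells_flip1 : dcells (flip T j) = [:: (0, 1); (1, 1)]%N.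
Proof. by rewrite ffunE j1 dcells_transpose cTj. Qed.

Lemma flip_ge2 (k : 'I_n) : (2 <= k)%N -> flip T k = T k.
Proof. by move=> k2; rewrite ffunE ltnNge k2. Qed.

Lemma lt2_ord (k : 'I_n) : (k < 2)%N -> k = i \/ k = j.
Proof.
case: k => [[|[|k]] h] // _; [left|right]; apply: val_inj; by rewrite ?i0 ?j1.
Qed.

(** With [cell_flip]: the entries 1 and 2 occupy the same four cells before and after the flip. *)
Lemma flip_cell (k : 'I_n) x : (k < 2)%N -> x \in dcells (flip T k) ->
  exists2 k' : 'I_n, (k' < 2)%N & x \in dcells (T k').
Proof.
case/lt2_ord => ->; rewrite ?dcells_flip0 ?dcells_flip1 !inE => /orP[] /eqP->.
- by exists i; rewrite ?i0 ?cTi.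
- by exists j; rewrite ?j1 ?cTj.
- by exists i; rewrite ?i0 ?cTi.
- by exists j; rewrite ?j1 ?cTj.
Qed.

Lemma cell_flip (k : 'I_n) x : (k < 2)%N -> x \in dcells (T k) ->
  exists2 k' : 'I_n, (k' < 2)%N & x \in dcells (flip T k').
Proof.
case/lt2_ord => ->; rewrite ?cTi ?cTj !inE => /orP[] /eqP->.
- by exists i; rewrite ?i0 ?dcells_flip0.
- by exists j; rewrite ?j1 ?dcells_flip1.
- by exists i; rewrite ?i0 ?dcells_flip0.
- by exists j; rewrite ?j1 ?dcells_flip1.
Qed.

(** Comparisons between the square and the rest only depend on whether an index is below 2, and so
    carry over from [T]. Inside the square the order is checked directly. *)
Lemma flip_SDT : is_SDT lam (flip T).
Proof.
apply/is_SDTP; split.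
- move=> k x; case: (ltnP k 2) => k2; last first.
    by rewrite flip_ge2 //; apply: SDT_in.
  by case/flip_cell => // k' _; apply: SDT_in.
- move=> k l x; case: (ltnP k 2) => k2; case: (ltnP l 2) => l2.
  + case: (lt2_ord k2) (lt2_ord l2) => -> [] -> //;
    by rewrite dcells_flip0 dcells_flip1 !inE => /orP[] /eqP->.
  + rewrite (flip_ge2 l2) => /(flip_cell k2)[k' k'2 xk'] /(SDT_uniq TS xk') e.
    by move: k'2; rewrite e; lia.
  + rewrite (flip_ge2 k2) => xk /(flip_cell l2)[l' l'2 /(SDT_uniq TS xk) e].
    by move: l'2; rewrite -e; lia.
  + by rewrite !flip_ge2 //; apply: SDT_uniq.
- move=> x /(SDT_cover TS)[k]; case: (ltnP k 2) => k2.
    by case/(cell_flip k2) => k' _; exists k'.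
  by exists k; rewrite flip_ge2.
- move=> k l x y; case: (ltnP k 2) => k2; case: (ltnP l 2) => l2.
  + case: (lt2_ord k2) (lt2_ord l2) => -> [] -> //; rewrite ?i0 ?j1 //.
    by rewrite dcells_flip0 dcells_flip1 !inE => /orP[] /eqP-> /orP[] /eqP->.
  + by lia.
  + rewrite (flip_ge2 k2) => xk /(flip_cell l2)[l' l'2 yl'] xy.
    by have := SDT_incr TS xk yl' xy; lia.
  + by rewrite !flip_ge2 //; apply: SDT_incr.
Qed.

End FlipSDT.

Lemma square_flip_SDT T (i : 'I_n) : i = 0%N :> nat -> is_SDT lam T ->
  ~~ vertical (T i) -> square T -> is_SDT lam (flip T).
Proof.
move=> i0 TS Th Tsq; have /existsP[j /andP[/eqP j1 _]] := Tsq.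
exact: (flip_SDT i0 j1).
Qed.

Lemma swap0E T (i : 'I_n) : i = 0%N :> nat -> is_SDT lam T ->
  ~~ vertical (T i) -> swap T i = if square T then Some (flip T) else None.
Proof.
move=> i0 TS Th; rewrite /swap i0 eqxx.
(* If [insub] fails there is no entry 2, and [square T] fails as well. *)
case: insubP => [j _ /= j1|n1]; last first.
  case: ifP => // /existsP[k /andP[/eqP k1 _]].
  by move: (ltn_ord k); rewrite k1 (negbTE n1).
have cTi := SDT_first_horizontal i0 TS Th.
have -> : is_tiling [:: 2; 2]%N [set T i; T j] = square T.
  rewrite (squareE _ j1); apply/andP/eqP => [[/forall_inP Tin /allP Tcov]|cTj].
    have jin : T j \in [set T i; T j] by rewrite !inE eqxx orbT.
    have /allP Tjin := Tin _ jin.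
    (* [T i] fills the top row, so the cell below the corner belongs to [T j]. A vertical [T j]
       would leave the square or contain the corner, which is taken. *)
    have /cards1P[d dE] := Tcov (1, 0)%N isT.
    have : d \in [set d] by rewrite inE.
    rewrite -dE !inE => /andP[/orP[] /eqP ->]; first by rewrite cTi.
    have /negP nw0 : ~~ ((0, 0)%N \in dcells (T j)).
      apply/negP => h; have := @SDT_uniq T i j (0,0)%N TS.
      by rewrite cTi => /(_ isT h) e; move: j1; rewrite -e i0.
    move: Tjin nw0; case: (T j) => [[r c] b] /=.
    move=> Tjin nw0; rewrite !inE => /orP[] /eqP[].
      move=> r1 c0; move: Tjin; rewrite -r1 -c0; case: b {nw0} => //.
      by move=> /(_ (2, 0)%N isT).
    by case: b nw0 {Tjin} => nw0 [] // r0 c0; case: nw0; rewrite -?r0 -?c0.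
  have Tij : T i != T j by apply/eqP => e; move: cTi; rewrite e cTj.
  split.
    by apply/forall_inP => d; rewrite !inE => /orP[]/eqP->; rewrite ?cTi ?cTj.
  apply/allP => x.
  have -> : diagram [:: 2; 2]%N = dcells (T i) ++ dcells (T j).
    by rewrite cTi cTj.
  rewrite mem_cat => xij; apply/cards1P.
  have [xi|xi] := boolP (x \in dcells (T i)).
    exists (T i); apply/setP => d; rewrite !inE.
    apply/andP/eqP => [[/orP[]/eqP-> //]|->]; last by rewrite eqxx xi.
    by move: xi; rewrite cTi cTj !inE => /orP[] /eqP->.
  exists (T j); apply/setP => d; rewrite !inE; rewrite (negbTE xi) /= in xij.
  apply/andP/eqP => [[/orP[]/eqP-> //]|->]; last by rewrite eqxx orbT xij.
  by rewrite (negbTE xi).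
case: ifP => // _; congr Some; apply/ffunP => k; rewrite !ffunE -!val_eqE /=.
by rewrite i0 j1; case: (val k) => [|[|]].
Qed.

End Flip.

End Tableaux.

(** * Relations between the operators *)

Section OperatorRelations.
Context (R : comNzRingType) (n : nat) (lam : seq nat).
Hypothesis lamP : is_partition_of n.*2 lam.
Local Notation V := (SDTmod R n lam).
Local Notation op := (@SDTop R n lam).
Implicit Types (T : filling n) (i j p q : 'I_n) (v : V).

Fact SDTop_is_linear i : linear (op i).
Proof.
move=> c u v; rewrite /SDTop scaler_sumr -big_split.
by apply: eq_bigr => T _; rewrite !ffunE scalerDl scalerA.
Qed.
HB.instance Definition _ i :=
  GRing.isLinear.Build R V V *:%R (op i) (SDTop_is_linear i).

Lemma op0 i : op i 0 = 0.
Proof. exact: raddf0. Qed.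

Lemma opN i v : op i (- v) = - op i v.
Proof. exact: raddfN. Qed.

Lemma SDTop_basisE i (U : SDT n lam) : op i (SDTbasis R U) = SDTop_basis R i U.
Proof.
rewrite /SDTop (bigD1 U) //= ffunE eqxx scale1r big1 ?addr0 // => W /negbTE WU.
by rewrite ffunE WU scale0r.
Qed.

Lemma SDTmod_expand v : v = \sum_(U : SDT n lam) v U *: SDTbasis R U.
Proof.
apply/ffunP => W; rewrite sum_ffunE (bigD1 W) //= !ffunE eqxx.
rewrite big1 ?addr0 => [|U]; first by rewrite /GRing.scale /= mulr1.
by rewrite !ffunE eq_sym => /negbTE ->; rewrite scaler0.
Qed.

(** Extending the basis vectors by 0 to all fillings avoids carrying standardness proofs, and makes
    nonstandard results of [swap] vanish as required. *)
Definition fbasis T : V :=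
  if insub T is Some U then SDTbasis R (U : SDT n lam) else 0.

Lemma linear_ext (f g : {linear V -> V}) :
  (forall T, is_SDT lam T -> f (fbasis T) = g (fbasis T)) -> f =1 g.
Proof.
move=> fg v; rewrite (SDTmod_expand v) !linear_sum; apply: eq_bigr => U _.
rewrite !linearZ; congr (_ *: _).
by have := fg (val U) (valP U); rewrite /fbasis valK.
Qed.

Lemma op_fbasis i T : is_SDT lam T ->
  op i (fbasis T) = if descent T i then - fbasis T
                    else if swap T i is Some U then fbasis U else 0.
Proof.
move=> TS; rewrite /fbasis (insubT (is_SDT lam) TS) SDTop_basisE.
rewrite /SDTop_basis /SDTswap /=; case: descent => //.
by case: swap => //= U; case: insubP.
Qed.

Lemma op_pos p i T : i = p.+1 :> nat -> is_SDT lam T ->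
  op i (fbasis T) = if low (T i) (T p) then - fbasis T
                    else if low (T p) (T i) then fbasis (exch p i T) else 0.
Proof.
move=> ip TS; have pE : pred_ord i = p by apply: val_inj; rewrite /= ip.
rewrite op_fbasis // /descent /swap pE ip /=.
case: ifPn => // l1; case: ifPn => // l2.
by rewrite /fbasis insubF //; apply: (exch_notSDT ip TS l2 l1).
Qed.

Lemma op_zero i T : i = 0%N :> nat -> is_SDT lam T ->
  op i (fbasis T) = if vertical (T i) then - fbasis T
                    else if square T then fbasis (flip T) else 0.
Proof.
move=> i0 TS; rewrite op_fbasis // /descent i0 /=; case: ifPn => // Th.
by rewrite (swap0E lamP) //; case: ifP.
Qed.

Lemma gt0_pred i : (0 < i)%N -> exists p : 'I_n, i = p.+1 :> nat.
Proof. by move=> i0; exists (pred_ord i); rewrite /= prednK. Qed.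

(** After an exchange or a flip, [i] is a descent of the new tableau, so the second application only
    contributes a sign. *)
Lemma op_quad i v : op i (op i v) = - op i v.
Proof.
apply: (linear_ext (f := op i \o op i) (g := \- op i)) v => T TS /=.
case: (posnP i) => [i0|/gt0_pred[p ip]].
  rewrite op_zero //; case: ifPn => Th; first by rewrite opN op_zero // Th.
  case: ifPn => Tsq; rewrite ?op0 ?oppr0 //.
  by rewrite op_zero ?vertical_flip ?Th //; apply: (square_flip_SDT lamP i0).
rewrite (op_pos ip) //; case: ifPn => l1.
  by rewrite opN (op_pos ip) // l1.
case: ifPn => l2; last by rewrite op0 oppr0.
by rewrite (op_pos ip) ?exchL ?exchR ?l2 //; apply: exch_SDT.
Qed.

Lemma op_braid3 i j v : (1 <= i)%N -> j = i.+1 :> nat ->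
  op i (op j (op i v)) = op j (op i (op j v)).
Proof.
move=> /gt0_pred[p ip] ji.
apply: (linear_ext (f := op i \o op j \o op i) (g := op j \o op i \o op j)) v.
move=> T TS /=.
(* [F a b c] is [T] with the dominoes at [p], [i], [j] replaced; the two exchanges then permute the
   triple. *)
pose F a b c : filling n := [ffun k => if k == p then a else if k == i then b
                                   else if k == j then c else T k].
have pi : p != i by rewrite -val_eqE /=; lia.
have ij : i != j by rewrite -val_eqE /=; lia.
have pj : p != j by rewrite -val_eqE /=; lia.
have Fp a b c : F a b c p = a by rewrite ffunE eqxx.
have Fi a b c : F a b c i = b by rewrite ffunE eqxx eq_sym (negbTE pi).
have Fj a b c : F a b c j = c.
  by rewrite ffunE eqxx ![j == _]eq_sym (negbTE pj) (negbTE ij).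
have exchF a b c : exch p i (F a b c) = F b a c.
  apply/ffunP => k; have [->|kp] := eqVneq k p; first by rewrite exchL Fi Fp.
  have [->|ki] := eqVneq k i; first by rewrite exchR Fi Fp.
  by rewrite exchD // !ffunE (negbTE kp) (negbTE ki).
have exchG a b c : exch i j (F a b c) = F a c b.
  apply/ffunP => k; have [->|ki] := eqVneq k i; first by rewrite exchL Fi Fj.
  have [->|kj] := eqVneq k j; first by rewrite exchR Fi Fj.
  by rewrite exchD // !ffunE (negbTE ki) (negbTE kj).
have TF : T = F (T p) (T i) (T j).
  by apply/ffunP => k; rewrite ffunE; do !case: eqP => [->|_].
rewrite TF in TS *.
apply: (@signed_moves_braid _ _ (@strictly_lower n)
          (fun a b c => is_SDT lam (F a b c)) (fun a b c => fbasis (F a b c))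
          (op i) (op j)) TS.
- exact: low_irr.
- exact: low_trans.
- by move=> a b c FS l; rewrite -exchF; apply: exch_SDT; rewrite ?Fp ?Fi.
- by move=> a b c FS l; rewrite -exchG; apply: exch_SDT; rewrite ?Fj ?Fi.
- by move=> a b c FS /=; rewrite (op_pos ip) // Fp Fi exchF.
- by move=> a b c FS /=; rewrite (op_pos ji) // Fj Fi exchG.
Qed.

Lemma op_comm_pos i j v : (0 < i)%N -> (i.+2 <= j)%N ->
  op i (op j v) = op j (op i v).
Proof.
move=> /gt0_pred[p ip] ij.
have /gt0_pred[q jq] : (0 < j)%N by lia.
apply: (linear_ext (f := op i \o op j) (g := op j \o op i)) v => T TS /=.
have [pq pj iq ijn] : [/\ p != q, p != j, i != q & i != j].
  by rewrite -!val_eqE /=; split; lia.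
apply: (@signed_moves_commute _ _ (is_SDT lam) fbasis (op i) (op j)
  (fun T => low (T i) (T p)) (fun T => low (T p) (T i))
  (fun T => low (T j) (T q)) (fun T => low (T q) (T j))
  (exch p i) (exch q j)) TS => {T}.
- by move=> T TS /=; rewrite (op_pos ip).
- by move=> T TS /=; rewrite (op_pos jq).
- by move=> T TS _; apply: exch_SDT.
- by move=> T TS _; apply: exch_SDT.
- by move=> T; rewrite !exchD.
- by move=> T; rewrite !exchD // eq_sym.
- move=> T; apply/ffunP => k; rewrite !ffunE; congr (T _).
  case: (tpermP p i k) => [->|->|/eqP kp /eqP ki].
  + by rewrite ![tperm q j _]tpermD ?tpermL // eq_sym.
  + by rewrite ![tperm q j _]tpermD ?tpermR // eq_sym.
  + by case: (tpermP q j k) => [_|_|_ _]; rewrite tpermD // eq_sym.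
Qed.

(** The exchange touches only indices at least 2, while the flip and its test involve only the
    indices 0 and 1. *)
Lemma op_comm_zero_far i j v : i = 0%N :> nat -> (3 <= j)%N ->
  op i (op j v) = op j (op i v).
Proof.
move=> i0 j3; have /gt0_pred[q jq] : (0 < j)%N by lia.
apply: (linear_ext (f := op i \o op j) (g := op j \o op i)) v => T TS /=.
have iq : i != q by rewrite -val_eqE /=; lia.
have ij : i != j by rewrite -val_eqE /=; lia.
apply: (@signed_moves_commute _ _ (is_SDT lam) fbasis (op i) (op j)
  (fun T => vertical (T i)) (@square n)
  (fun T => low (T j) (T q)) (fun T => low (T q) (T j))
  (@flip n) (exch q j)) TS => {T}.
- by move=> T TS /=; rewrite (op_zero i0).
- by move=> T TS /=; rewrite (op_pos jq).
- by move=> T TS; apply: square_flip_SDT i0 TS.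
- by move=> T TS _; apply: exch_SDT.
- move=> T; rewrite exchD //; split=> //.
  rewrite /square; apply: eq_existsb => k.
  have [k1|//] := eqVneq (k : nat) 1%N.
  by rewrite exchD // -val_eqE /=; lia.
- by move=> T; rewrite !flip_ge2 //; lia.
- move=> T; apply/ffunP => k; rewrite !ffunE.
  suff -> : (tperm q j k < 2)%N = (k < 2)%N by [].
  by case: tpermP => [->|->|_ _] //; lia.
Qed.

Lemma op_comm_zero_two i j v : i = 0%N :> nat -> j = 2%N :> nat ->
  op i (op j v) = op j (op i v).
Proof.
move=> i0 j2; have /gt0_pred[q jq] : (0 < j)%N by lia.
apply: (linear_ext (f := op i \o op j) (g := op j \o op i)) v => T TS /=.
have q1 : q = 1%N :> nat by lia.
have iq : i != q by rewrite -val_eqE /=; lia.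
have ij : i != j by rewrite -val_eqE /=; lia.
(* The exchange leaves [T i] in place, so for vertical [T i] both sides equal minus the image under
   [op j]. *)
have [Tv|Th] := boolP (vertical (T i)).
  rewrite [op i (fbasis T)]op_zero // Tv opN.
  rewrite (op_pos jq) //; case: ifPn => l1; first by rewrite !opN op_zero // Tv.
  case: ifPn => l2; rewrite ?op0 ?oppr0 //.
  by rewrite op_zero ?exchD ?Tv //; apply: exch_SDT.
rewrite [op i (fbasis T)]op_zero // (negbTE Th).
have opjF : square T -> op j (fbasis (flip T)) =
    if low (T j) (T q) then - fbasis (flip T) else 0.
  move=> Tsq; have FS := square_flip_SDT lamP i0 TS Th Tsq.
  have cTq : dcells (T q) = [:: (1, 0); (1, 1)]%N.
    by apply/eqP; rewrite -squareE.
  have cFq := dcells_flip1 q1 Tsq.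
  (* The flipped second domino meets row 0, so it is strictly lower than nothing; its last row is
     still 1, so being strictly below it means the same as before. *)
  have lFT : low (flip T q) (T j) = false.
    by rewrite /strictly_lower cFq /=; case: (dcells (T j)) (nw_in (T j)).
  have lTF : low (T j) (flip T q) = low (T j) (T q).
    rewrite /strictly_lower cFq cTq; apply: eq_all => x /=.
    by case: (x.1) => [|[|r]].
  by rewrite (op_pos jq) // flip_ge2 ?j2 // lTF lFT.
rewrite (op_pos jq) //; case: ifPn => l1.
  rewrite opN op_zero // (negbTE Th); case: ifPn => Tsq; rewrite ?op0 ?oppr0 //.
  by rewrite opjF // l1.
(* Both sides vanish: if pi_j exchanges two entries, then the new second domino
   does not complete the northwest square.  If it did, the cell below the corner
   would carry entry 3 in T, but the domino with entry 2 is strictly lower and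
   thus forces an entry at most 2 there. *)
have -> : op j (if square T then fbasis (flip T) else 0) = 0.
  by case: ifPn => Tsq; rewrite ?op0 // opjF // (negbTE l1).
case: ifPn => l2; last by rewrite op0.
rewrite op_zero ?exchD ?(negbTE Th) //; last exact: exch_SDT.
rewrite (squareE _ q1) exchL ifN //; apply/negP => /eqP cTj.
have [l lq lT] : exists2 l : 'I_n, (l <= q)%N & (1, 0)%N \in dcells (T l).
  apply: (SDT_nw lamP TS (nw_in (T q))) => //.
  by move: l2; rewrite lowE; lia.
have := @SDT_uniq _ _ T l j (1, 0)%N TS lT.
by rewrite cTj => /(_ isT) lj; move: lq; rewrite lj; lia.
Qed.

(** If [op i] is scalar on the basis vector of [T], so is [op j], and both words agree. Otherwise
    [op i] produces the flip, which [op j] kills because its first two dominoes are vertical side by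
    side; both words then vanish. *)
Lemma op_braid4 i j v : i = 0%N :> nat -> j = 1%N :> nat ->
  op i (op j (op i (op j v))) = op j (op i (op j (op i v))).
Proof.
move=> i0 j1; have j_gt0 : j = i.+1 :> nat by lia.
apply: (linear_ext (f := op i \o op j \o op i \o op j)
                   (g := op j \o op i \o op j \o op i)) v => T TS /=.
have lowi U : is_SDT lam U -> low (U i) (U j) = false.
  by move=> US; rewrite lowE (SDT_first lamP i0 US).1.
have opj U : is_SDT lam U ->
    op j (fbasis U) = if low (U j) (U i) then - fbasis U else 0.
  by move=> US; rewrite (op_pos j_gt0) // lowi.
have ojT := opj T TS.
have [Tv|Th] := boolP (vertical (T i)).
  have oiT : op i (fbasis T) = - fbasis T by rewrite op_zero // Tv.
  by move: ojT; case: ifP => _ ojT; rewrite !(ojT, oiT, opN, op0, oppr0).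
have oiT : op i (fbasis T) = if square T then fbasis (flip T) else 0.
  by rewrite op_zero // (negbTE Th).
have [Tsq|Tsq] := boolP (square T); last first.
  rewrite (negbTE Tsq) in oiT.
  by move: ojT; case: ifP => _ ojT; rewrite !(ojT, oiT, opN, op0, oppr0).
have ojF : op j (fbasis (flip T)) = 0.
  rewrite opj; last exact: (square_flip_SDT lamP i0 TS Th Tsq).
  rewrite /strictly_lower (dcells_flip0 lamP i0 TS Th).
  by rewrite (dcells_flip1 j1 Tsq).
rewrite Tsq in oiT.
by move: ojT; case: ifP => _ ojT; rewrite !(ojT, oiT, ojF, opN, op0, oppr0).
Qed.

Lemma op_comm i j v : (i.+2 <= j)%N -> op i (op j v) = op j (op i v).
Proof.
case: (posnP i) => [i0|]; last exact: op_comm_pos.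
rewrite i0 leq_eqVlt => /predU1P[j2|]; first exact: op_comm_zero_two.
exact: op_comm_zero_far.
Qed.

End OperatorRelations.

(* The complex numbers are R[i] for a real number structure R. *)
Theorem theorem4p2 (R : realType) (n : nat) (lam : seq nat)
    (Hlam : is_partition_of n.*2 lam) :
  exists act : heckeB0 R[i] n -> SDTmod R[i] n lam -> SDTmod R[i] n lam,
    is_algebra_action act /\
    forall (i : 'I_n) (v : SDTmod R[i] n lam),
      act (heckeB0_gen R[i] i) v = SDTop i v.
Proof.
pose op i : {linear SDTmod R[i] n lam -> SDTmod R[i] n lam} :=
  @SDTop R[i] n lam i.
have quad := @op_quad R[i] n lam Hlam.
have comm := @op_comm R[i] n lam Hlam.
have braid3 := @op_braid3 R[i] n lam Hlam.
have braid4 := @op_braid4 R[i] n lam Hlam.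
exists (hecke_act op); split.
  exact: (hecke_act_is_action (op := op) quad comm braid3 braid4).
exact: (hecke_act_gen (op := op) quad comm braid3 braid4).
Qed.
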